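(* Let $\Bbbk$ be a field with $\operatorname{char}(\Bbbk)\neq 2$, let $H_4$ be the Sweedler algebra over $\Bbbk$ with basis $1,g,x,gx$, and let $L=H_4^{(-)}$ be the associated Lie algebra. 1. For any $\lambda\in\Bbbk$ the linear map given by $B_{-1}(1)=1$, $B_{-1}(g)=g$, $B_{-1}(x)=B_{-1}(gx)=0$ is a Lie algebra RB--operator of weight $\lambda$ on $L$. 2. For any $a\in\Bbbk$ the linear map given by $B_{-1}(1)=1$, $B_{-1}(g)=g$, $B_{-1}(x)=B_{-1}(gx)=a-ag$ is a Lie algebra RB--operator of weight $\lambda=-1$ on $L$. 3. The linear map given by $B_{-1}(1)=1$, $B_{-1}(g)=g$, $B_{-1}(x)=B_{-1}(gx)=-x+gx$ is a Lie algebra RB--operator of weight $\lambda=-2$ on $L$. 4. The linear map given by $B_{-1}(1)=1$, $B_{-1}(g)=g$, $B_{-1}(x)=-B_{-1}(gx)=x+gx$ is a Lie algebra RB--operator of weight $\lambda=-2$ on $L$.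
   Context: The Sweedler algebra $H_4$ is, as an associative algebra, the 4-dimensional $\Bbbk$-algebra with basis $1,g,x,gx$, generated by $g,x$ with relations $g^2=1$, $x^2=0$, $xg=-gx$. The Lie algebra $L=H_4^{(-)}$ is the vector space $H_4$ with bracket $[a,b]=ab-ba$. A Lie algebra RB--operator of weight $\lambda\in\Bbbk$ on $L$ is a linear map $B\colon L\to L$ such that $[B(a),B(b)]=B([a,B(b)]+[B(a),b]+\lambda[a,b])$ for all $a,b\in L$. *)

(* Defs.v *)
From HB Require Import structures.
From mathcomp Require Import all_boot all_order all_algebra all_field.
From mathcomp Require Import ring.

Set Implicit Arguments.
Unset Strict Implicit.
Unset Printing Implicit Defensive.

Import GRing.Theory.
Local Open Scope ring_scope.

HB.mixin Record isLieAlgebra (K : fieldType) L of GRing.Lmodule K L := {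
  lie : L -> L -> L;
  lie_linearl : forall c : L, linear (lie^~ c);
  lie_linearr : forall a : L, linear (lie a);
  liexx : forall a : L, lie a a = 0;
  lie_jacobi : forall a b c : L,
    lie a (lie b c) + lie b (lie c a) + lie c (lie a b) = 0
}.

#[short(type="lieAlgType")]
HB.structure Definition LieAlgebra (K : fieldType) :=
  { L of GRing.Lmodule K L & isLieAlgebra K L }.

Reserved Notation "[ 'Lie' a , b ]" (format "[ 'Lie'  a ,  b ]").
Notation "[ 'Lie' a , b ]" := (lie a b) : ring_scope.

Definition RB_operator (K : fieldType) (L : lieAlgType K) (lambda : K)
    (B : {linear L -> L}) : Prop :=
  forall a b : L,
    [Lie B a, B b] = B ([Lie a, B b] + [Lie B a, b] + lambda *: [Lie a, b]).

(* An alias of the carrier of A, so that the Lie structure given by the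
   commutator is not forced upon every associative algebra. *)
Definition commLie (K : fieldType) (A : algType K) : Type := A.

Notation "A ^(-)" := (commLie A) (at level 1, format "A ^(-)") : type_scope.

Section CommLie.
Variables (K : fieldType) (A : algType K).

HB.instance Definition _ := GRing.Lmodule.copy A^(-) A.

Definition comm_bracket (a b : A) : A := a * b - b * a.

Fact comm_bracket_linearl (c : A) : linear (comm_bracket^~ c).
Proof.
move=> k a b; rewrite /comm_bracket mulrDl mulrDr -scalerAl -scalerAr.
by rewrite scalerBr opprD addrACA.
Qed.

Fact comm_bracket_linearr (c : A) : linear (comm_bracket c).
Proof.
move=> k a b; rewrite /comm_bracket mulrDl mulrDr -scalerAl -scalerAr.
by rewrite scalerBr opprD addrACA.
Qed.

Fact comm_bracketxx (a : A) : comm_bracket a a = 0.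
Proof. exact: subrr. Qed.

Fact comm_bracket_jacobi (a b c : A) :
  comm_bracket a (comm_bracket b c) + comm_bracket b (comm_bracket c a)
    + comm_bracket c (comm_bracket a b) = 0.
Proof.
rewrite /comm_bracket !(mulrBl, mulrBr) !mulrA.
set x1 := a * b * c; set x2 := a * c * b; set x3 := b * c * a.
set x4 := b * a * c; set x5 := c * a * b; set x6 := c * b * a.
have E (p q r s : A) : p - q - (r - s) = (p + s) - (q + r).
  by rewrite opprB opprD addrACA.
rewrite !E (addrC x5 x4) (addrC x3 x2) (addrC x6 x1).
by rewrite !subrKA subrr.
Qed.

HB.instance Definition _ := isLieAlgebra.Build K A^(-)
  comm_bracket_linearl comm_bracket_linearr comm_bracketxx comm_bracket_jacobi.
End CommLie.

(* Coordinates are relative to the basis 1, g, x, gx. *)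
Definition H4 (k : fieldType) : Type := 'rV[k]_4.

Section Sweedler.
Variable k : fieldType.

HB.instance Definition _ := Vector.copy (H4 k) 'rV[k]_4.

Definition H4_of (a b c d : k) : H4 k := \row_(i < 4) [:: a; b; c; d]`_i.

(* The multiplication table forced by g^2 = 1, x^2 = 0 and xg = -gx. *)
Definition H4_mul (u v : H4 k) : H4 k :=
  H4_of (u 0 0 * v 0 0 + u 0 1 * v 0 1)
        (u 0 0 * v 0 1 + u 0 1 * v 0 0)
        (u 0 0 * v 0 2 + u 0 2 * v 0 0 + u 0 1 * v 0 3 - u 0 3 * v 0 1)
        (u 0 0 * v 0 3 + u 0 3 * v 0 0 + u 0 1 * v 0 2 - u 0 2 * v 0 1).

Fact H4P (u v : H4 k) :
  u 0 0 = v 0 0 -> u 0 1 = v 0 1 -> u 0 2 = v 0 2 -> u 0 3 = v 0 3 -> u = v.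
Proof.
move=> e0 e1 e2 e3; apply/rowP => i.
have: i \in [:: 0; 1; 2; 3] by case: i => [] [|[|[|[|?]]]].
by rewrite !inE => /or4P[] /eqP->.
Qed.

Fact H4_mulA : associative H4_mul.
Proof. by move=> u v w; apply: H4P; rewrite !mxE /=; ring. Qed.

Fact H4_mul1r : left_id (H4_of 1 0 0 0) H4_mul.
Proof. by move=> u; apply: H4P; rewrite !mxE /=; ring. Qed.

Fact H4_mulr1 : right_id (H4_of 1 0 0 0) H4_mul.
Proof. by move=> u; apply: H4P; rewrite !mxE /=; ring. Qed.

Fact H4_mulDl : left_distributive H4_mul +%R.
Proof. by move=> u v w; apply: H4P; rewrite !mxE /=; ring. Qed.

Fact H4_mulDr : right_distributive H4_mul +%R.
Proof. by move=> u v w; apply: H4P; rewrite !mxE /=; ring. Qed.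

Fact H4_oner_neq0 : H4_of 1 0 0 0 != 0.
Proof. by apply/eqP => /rowP/(_ 0); rewrite !mxE /=; apply/eqP/oner_neq0. Qed.

HB.instance Definition _ := GRing.Zmodule_isNzRing.Build (H4 k)
  H4_mulA H4_mul1r H4_mulr1 H4_mulDl H4_mulDr H4_oner_neq0.

Fact H4_scalerAl (c : k) (u v : H4 k) : c *: (u * v) = (c *: u) * v.
Proof. by apply: H4P; rewrite !mxE /=; ring. Qed.

HB.instance Definition _ := GRing.Lmodule_isLalgebra.Build k (H4 k) H4_scalerAl.

Fact H4_scalerAr (c : k) (u v : H4 k) : c *: (u * v) = u * (c *: v).
Proof. by apply: H4P; rewrite !mxE /=; ring. Qed.

HB.instance Definition _ := GRing.Lalgebra_isAlgebra.Build k (H4 k) H4_scalerAr.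
HB.instance Definition _ := Algebra_isFalgebra.Build k (H4 k).

Definition H4g : H4 k := H4_of 0 1 0 0.
Definition H4x : H4 k := H4_of 0 0 1 0.
Definition H4_basis : 4.-tuple (H4 k) := [tuple 1; H4g; H4x; H4g * H4x].

Lemma H4_gg : H4g * H4g = 1.
Proof. by apply: H4P; rewrite !mxE /=; ring. Qed.

Lemma H4_xx : H4x * H4x = 0.
Proof. by apply: H4P; rewrite !mxE /=; ring. Qed.

Lemma H4_xg : H4x * H4g = - (H4g * H4x).
Proof. by apply: H4P; rewrite !mxE /=; ring. Qed.

Lemma H4_basisP : basis_of fullv H4_basis.
Proof.
rewrite basisEdim size_tuple dimvf /dim /= mul1n leqnn andbT.
apply/subvP => u _.
have -> : u = u 0 0 *: 1 + u 0 1 *: H4g + u 0 2 *: H4x + u 0 3 *: (H4g * H4x).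
  by apply: H4P; rewrite !mxE /=; ring.
by rewrite !memvD // memvZ // memv_span // !inE eqxx ?orbT.
Qed.
End Sweedler.

Section BasisMap.
Variables (k : fieldType) (U : vectType k) (V : lmodType k) (n : nat).
Variables (X : n.-tuple U) (Y : n.-tuple V).

(* When X is a basis of U, the linear map sending X`_i to Y`_i for every i. *)
Definition basis_map (u : U) : V := \sum_(i < n) coord X i u *: Y`_i.

Fact basis_map_linear : linear basis_map.
Proof.
move=> c u v; rewrite /basis_map scaler_sumr -big_split /=.
by apply: eq_bigr => i _; rewrite linearP scalerDl scalerA.
Qed.

HB.instance Definition _ :=
  GRing.isLinear.Build k U V *:%R basis_map basis_map_linear.

Lemma basis_mapE (i : 'I_n) : free X -> basis_map X`_i = Y`_i.
Proof.
move=> frX; rewrite /basis_map (bigD1 i) //= coord_free // eqxx scale1r.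
rewrite big1 ?addr0 // => j neq_ji.
by rewrite coord_free // eq_sym (negbTE neq_ji) scale0r.
Qed.
End BasisMap.

(* Main.v *)
Require Import Defs.
From HB Require Import structures.
From mathcomp Require Import all_boot all_order all_algebra all_field.
From mathcomp Require Import ring.

Set Implicit Arguments.
Unset Strict Implicit.
Unset Printing Implicit Defensive.

Import GRing.Theory.
Local Open Scope ring_scope.

(** In [L] the unit is central, [x] and [gx] span an abelian ideal [P] containing every bracket, and
    [D = ad g] swaps [x] and [gx] up to the factor 2. [H4_lieE] records this in coordinates and
    [H4_basis_mapE] does the same for [B], so each case becomes polynomial identities in the entries
    of [u] and [v], settled by [ring]. *)

Lemma H4_ofE (k : fieldType) (a b c d : k) :
  ((H4_of a b c d 0 0 = a) * (H4_of a b c d 0 1 = b)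
   * (H4_of a b c d 0 2 = c) * (H4_of a b c d 0 3 = d))%type.
Proof. by rewrite !mxE. Qed.

Lemma H4_ofD (k : fieldType) (a b c d a' b' c' d' : k) :
  H4_of a b c d + H4_of a' b' c' d' = H4_of (a + a') (b + b') (c + c') (d + d').
Proof. by apply: H4P; rewrite !mxE. Qed.

Lemma H4_ofZ (k : fieldType) (e a b c d : k) :
  e *: H4_of a b c d = H4_of (e * a) (e * b) (e * c) (e * d).
Proof. by apply: H4P; rewrite !mxE. Qed.

(** Trades the abstract [coord] of [basis_map] for the entries of the row [u]. *)
Lemma H4_basis_mapE (k : fieldType) (V : lmodType k) (b1 bg bx bgx : V)
    (u : H4 k) :
  basis_map (H4_basis k) [tuple b1; bg; bx; bgx] u =
  u 0 0 *: b1 + u 0 1 *: bg + u 0 2 *: bx + u 0 3 *: bgx.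
Proof.
have {1}-> : u = u 0 0 *: (H4_basis k)`_(0%R : 'I_4)
    + u 0 1 *: (H4_basis k)`_(1%R : 'I_4) + u 0 2 *: (H4_basis k)`_(2%R : 'I_4)
    + u 0 3 *: (H4_basis k)`_(3%R : 'I_4).
  by apply: H4P; rewrite !mxE /=; ring.
have B_E i := basis_mapE [tuple b1; bg; bx; bgx] i (basis_free (H4_basisP k)).
rewrite !linearD !linearZ_LR.
by congr (_ *: _ + _ *: _ + _ *: _ + _ *: _); exact: B_E.
Qed.

(** Only [[g, x] = 2gx] and [[g, gx] = 2x] survive, as [1] is central and [x], [gx] multiply to 0 in
    either order. *)
Lemma H4_lieE (k : fieldType) (u v : H4 k) :
  lie (u : (H4 k)^(-)) v =
  H4_of 0 0 (2 * (u 0 1 * v 0 3 - u 0 3 * v 0 1))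
            (2 * (u 0 1 * v 0 2 - u 0 2 * v 0 1)).
Proof. by apply: H4P; rewrite !mxE /=; ring. Qed.

Theorem proposition4p4 (k : fieldType) (hk : 2%N \notin [pchar k]) :
  let L : lieAlgType k := (H4 k)^(-) in
  let g : H4 k := H4g k in
  let x : H4 k := H4x k in
  let B (b1 bg bx bgx : H4 k) : {linear L -> L} :=
    basis_map (H4_basis k) [tuple b1; bg; bx; bgx] in
  [/\ forall lambda : k, RB_operator lambda (B 1 g 0 0),
      forall a : k, RB_operator (-1) (B 1 g (a *: 1 - a *: g) (a *: 1 - a *: g)),
      RB_operator (-2) (B 1 g (- x + g * x) (- x + g * x))
    & RB_operator (-2) (B 1 g (x + g * x) (- (x + g * x)))].
Proof.
move=> L g x B.
have BE b1 bg bx bgx u : B b1 bg bx bgx u =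
    u 0 0 *: b1 + u 0 1 *: bg + u 0 2 *: bx + u 0 3 *: bgx.
  exact: H4_basis_mapE.
split=> [lambda|a||].
(* The image of [B] is abelian and its kernel is [P], so both sides vanish for every weight. *)
- have Bu u : B 1 g 0 0 u = H4_of (u 0 0) (u 0 1) 0 0.
    by rewrite BE; apply: H4P; rewrite !mxE /=; ring.
  (* B is generalized since H4_ofD would also rewrite inside its arguments. *)
  move: (B _ _ _ _) Bu => f Bu u v; rewrite !H4_lieE H4_ofZ !H4_ofD !Bu !H4_ofE.
  by congr H4_of; ring.
(* The image is again abelian. On [P], [B] sees only the sum of the two coordinates; in that sum the
   terms in [a] cancel, and weight -1 cancels the rest. *)
- have Bu u : B 1 g (a *: 1 - a *: g) (a *: 1 - a *: g) u =
      H4_of (u 0 0 + a * (u 0 2 + u 0 3)) (u 0 1 - a * (u 0 2 + u 0 3)) 0 0.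
    by rewrite BE; apply: H4P; rewrite !mxE /=; ring.
  move: (B _ _ _ _) Bu => f Bu u v; rewrite !H4_lieE H4_ofZ !H4_ofD !Bu !H4_ofE.
  by congr H4_of; ring.
(* The vectors [x + gx] and [-x + gx] are eigenvectors of [D] for 2 and -2. The restriction [N] of
   [B] to [P] sends the first to a multiple of the second and kills the second, so [NN = 0] and
   [DN = -ND]; this gives weight -2. *)
- have Bu u : B 1 g (- x + g * x) (- x + g * x) u =
      H4_of (u 0 0) (u 0 1) (- (u 0 2 + u 0 3)) (u 0 2 + u 0 3).
    by rewrite BE; apply: H4P; rewrite !mxE /=; ring.
  move: (B _ _ _ _) Bu => f Bu u v; rewrite !H4_lieE H4_ofZ !H4_ofD !Bu !H4_ofE.
  by congr H4_of; ring.
(* Same mechanism with the two eigenvectors exchanged. *)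
have Bu u : B 1 g (x + g * x) (- (x + g * x)) u =
    H4_of (u 0 0) (u 0 1) (u 0 2 - u 0 3) (u 0 2 - u 0 3).
  by rewrite BE; apply: H4P; rewrite !mxE /=; ring.
move: (B _ _ _ _) Bu => f Bu u v; rewrite !H4_lieE H4_ofZ !H4_ofD !Bu !H4_ofE.
by congr H4_of; ring.
Qed.
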